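(* Let $p\ge2$ be an integer, $\mu\ge0$, $s>0$. Let $h:\mathbb{R}^n\to\mathbb{R}$ be $1$-uniformly convex of order $p$, and let $f:\mathbb{R}^n\to\mathbb{R}$ be $\mu$-uniformly convex (possibly $\mu=0$) with respect to $h$ and $\frac{(p-1)!}{s}$-smooth of order $p-1$, with a minimizer $x^*$. Let $G_{p,M}$ be a tensor update operator with constant $M>0$ and let $C=\frac1p\left(\frac{M}{p-1}\right)^{p-1}$. Let $(\mathbf{t}_k)_{k\ge0}$ be a strictly increasing sequence in $[0,\infty)$, set $A_k=C\mathbf{t}_k^p\operatorname{sinhc}_p^p\left(C^{1/p}\mu^{1/p}\mathbf{t}_k\right)$, and suppose that for all $k\ge0$ $$(A_{k+1}-A_k)^p-Cp^psA_{k+1}^{p-1}(1+\mu A_k)\le0.$$ Let the iterates of the unified accelerated tensor method family be generated from $x_0=z_0\in\mathbb{R}^n$ by, for $k\ge0$, $$y_k=x_k+\frac{A_{k+1}-A_k}{A_{k+1}}(z_k-x_k),\qquad x_{k+1}=G_{p,M}(y_k),$$ $$z_{k+1}=\arg\min_z\left\{\frac{A_{k+1}-A_k}{1+\mu A_k}\left(\langle\nabla f(x_{k+1}),z\rangle+\mu D_h(z,x_{k+1})\right)+D_h(z,z_k)\right\}.$$ Then for all $k\ge0$ (with $A_k>0$), $$f(x_k)-f(x^* )\le\frac{1}{A_k}\left((1+\mu A_0)D_h(x^*,x_0)+A_0\left(f(x_0)-f(x^* )\right)\right).$$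
   Context: $\sinh_p:[0,\infty)\to\mathbb{R}$ solves $\sinh_p'(t)=(1+\sinh_p^p(t))^{1/p}$, $\sinh_p(0)=0$; $\operatorname{sinhc}_p(x)=\sinh_p(x)/x$ for $x\ne0$, $\operatorname{sinhc}_p(0)=1$. The functions $f,h$ are continuously differentiable ($f$ also $p-1$ times differentiable). $D_g(y,x)=g(y)-g(x)-\langle\nabla g(x),y-x\rangle$. $h$ is $1$-uniformly convex of order $p$ if $D_h(y,x)\ge\frac1p\|y-x\|^p$ for all $x,y$. $f$ (convex) is $\mu$-uniformly convex with respect to $h$ if $D_f(x,y)\ge\mu D_h(x,y)$ for all $x,y$. $f$ is $L$-smooth of order $p-1$ if $\|\nabla^{p-1}f(y)-\nabla^{p-1}f(x)\|\le L\|y-x\|$ for all $x,y$. Tensor update operator: for $N>0$, $G_{p,s,N}(y)=\arg\min_x\left\{f_{p-1}(x;y)+\frac{N}{ps}\|x-y\|^p\right\}$, where $f_{p-1}(x;y)=\sum_{i=0}^{p-1}\frac{1}{i!}\nabla^if(y)(x-y)^i$ is the $(p-1)$-st order Taylor approximation of $f$ at $y$. $G_{p,M}:\mathbb{R}^n\to\mathbb{R}^n$ denotes such an operator, with $N$ chosen so that for every $y$, the point $x=G_{p,M}(y)$ satisfies $$\langle\nabla f(x),y-x\rangle\ge Ms^{\frac{1}{p-1}}\|\nabla f(x)\|^{\frac{p}{p-1}}.$$ *)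

(* Defs.v *)
From HB Require Import structures.
From mathcomp Require Import all_boot all_order all_algebra.
From mathcomp Require Import all_classical all_reals all_analysis.

Set Implicit Arguments.
Unset Strict Implicit.
Unset Printing Implicit Defensive.

Import Order.TTheory GRing.Theory Num.Theory.
Import numFieldNormedType.Exports.

Local Open Scope classical_set_scope.
Local Open Scope ring_scope.

(* R^n is ['rV[R]_n]; its library norm [`|v|] is the
   sup norm, which gives the usual topology and differentials. All norms
   appearing in formulas are Euclidean, hence [dot] and [enorm]. *)

Section Euclidean.
Variables (R : realType) (n : nat).
Local Notation V := 'rV[R]_n.

Definition dot (u v : V) : R := \sum_(i < n) u 0 i * v 0 i.

Definition enorm (v : V) : R := Num.sqrt (dot v v).

Definition grad (f : V -> R) (x : V) : V :=
  \row_(i < n) ('d f x (delta_mx 0 i) : R).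

Definition continuously_differentiable (f : V -> R) : Prop :=
  (forall x, differentiable f x) /\ continuous (grad f).

(* [nabla f [:: v1; ...; vm] x] is the multilinear form (D^m f)(x) evaluated at
   (v1, ..., vm), by D^m f(x)(v1, ..., vm) = D(D^(m-1) f(.)(v2, ..., vm))(x)(v1).
   It is meaningful when f is m times differentiable. *)
Fixpoint nabla (f : V -> R) (vs : seq V) : V -> R :=
  if vs is v :: vs' then fun x => 'd (nabla f vs') x v else f.

(* D^j f takes values in a finite-dimensional space of multilinear forms, so it
   is Frechet differentiable iff each of its evaluations is. *)
Definition times_differentiable (m : nat) (f : V -> R) : Prop :=
  forall (vs : seq V) (x : V), (size vs < m)%N -> differentiable (nabla f vs) x.

(* The supremum is taken in [\bar R], so an unbounded form has norm [+oo]. *)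
Definition form_norm (m : nat) (T : m.-tuple V -> R) : \bar R :=
  ereal_sup [set `|T vs|%:E | vs in
    [set vs : m.-tuple V | forall i : 'I_m, enorm (tnth vs i) <= 1]].

Definition smooth_of_order (m : nat) (L : R) (f : V -> R) : Prop :=
  forall x y : V,
    (form_norm (fun vs : m.-tuple V => (nabla f vs y - nabla f vs x)%R)
       <= (L * enorm (y - x))%:E)%E.

Definition bregman (g : V -> R) (y x : V) : R :=
  g y - g x - dot (grad g x) (y - x).

Definition uniformly_convex_of_order (sigma : R) (p : nat) (h : V -> R) : Prop :=
  forall x y : V, sigma / p%:R * enorm (y - x) ^+ p <= bregman h y x.

Definition uniformly_convex_wrt (mu : R) (h f : V -> R) : Prop :=
  convex_function [set: V] f /\
  forall x y : V, mu * bregman h x y <= bregman f x y.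

Definition is_argmin (F : V -> R) (x : V) : Prop := forall z, F x <= F z.

Definition taylor (m : nat) (f : V -> R) (y x : V) : R :=
  \sum_(i < m.+1) (i`!)%:R^-1 * nabla f (nseq i (x - y)) y.

(* When the argmin is not a singleton, [G] is any selection of it. *)
Definition tensor_update (p : nat) (s N : R) (f : V -> R) (G : V -> V) : Prop :=
  forall y : V,
    is_argmin (fun x => taylor p.-1 f y x + N / (p%:R * s) * enorm (x - y) ^+ p)
              (G y).

Definition tensor_update_operator (p : nat) (s M : R) (f : V -> R) (G : V -> V)
    : Prop :=
  exists N : R, [/\ 0 < N, tensor_update p s N f G &
    forall y : V,
      M * s `^ (p.-1%:R^-1) * enorm (grad f (G y)) `^ (p%:R / p.-1%:R)
        <= dot (grad f (G y)) (y - G y)].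

End Euclidean.

Section Sinhp.
Variable R : realType.

(* Only the values on [0, +oo[ are constrained; the derivative is relative to
   that half-line, hence one-sided at 0. The initial value problem has exactly
   one solution there. *)
Definition is_sinhp (p : nat) (sinhp : R -> R) : Prop :=
  sinhp 0 = 0 /\
  forall t : R, 0 <= t ->
    (sinhp u - sinhp t) / (u - t) @[u --> within `[0, +oo[ t^']
      --> (1 + sinhp t ^+ p) `^ (p%:R^-1).

Definition sinhc (sinhp : R -> R) (x : R) : R :=
  if x == 0 then 1 else sinhp x / x.

End Sinhp.

(* Main.v *)
Require Import Defs.
From HB Require Import structures.
From mathcomp Require Import all_boot all_order all_algebra.
From mathcomp Require Import all_classical all_reals all_analysis.
From mathcomp Require Import ring lra.

Set Implicit Arguments.
Unset Strict Implicit.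
Unset Printing Implicit Defensive.

Import Order.TTheory GRing.Theory Num.Theory.
Import numFieldNormedType.Exports.

Local Open Scope classical_set_scope.
Local Open Scope ring_scope.

(** The proof is a Lyapunov argument.  Along the iterates, the energy

      E_k = (1 + mu A_k) D_h(x_min, z_k) + A_k (f(x_k) - f(x_min))

    never increases.  Since the Bregman term is nonnegative,
    A_k (f(x_k) - f(x_min)) <= E_k <= E_0, and division by A_k gives the bound.

    For one step put a = A_{k+1} - A_k, B = 1 + mu A_k and g = grad f(x_{k+1}).
    The objective minimized by z_{k+1} is a multiple of h plus an affine
    function, so it exceeds its minimum at w by exactly that multiple of
    D_h(w, z_{k+1}) ([bregman_argmin]).  At w = x_min the multiple, cleared of the
    denominator B, is 1 + mu A_{k+1}: this is the coefficient in E_{k+1}.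
    Lower bounds for f at x_min (with its uniform convexity) and at x_k (plain
    convexity), together with A_{k+1} y_k = A_k x_k + a z_k, then give
    ([energy_step])

      E_{k+1} - E_k <= - A_{k+1} <g, y_k - x_{k+1}>
                       + a <g, z_k - z_{k+1}> - B D_h(z_{k+1}, z_k).

    The tensor step bounds the first inner product below by
    M s^{1/(p-1)} |g|^{p/(p-1)}, Cauchy-Schwarz bounds the second by
    |g| |z_k - z_{k+1}|, and uniform convexity of h makes the subtracted term at least
    B |z_k - z_{k+1}|^p / p.  That the resulting right-hand side is nonpositive
    is Young's inequality with exponents p/(p-1) and p; the growth condition on
    A is exactly what makes the constants fit ([tensor_step_young]).

    These estimates are multiplied by A_k and by a, so they need
    0 <= A_k <= A_{k+1}.  The derivative of sinh_p is a value of a real power,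
    hence nonnegative whatever the sign of the base, so sinh_p is nondecreasing
    ([sinhp_nondecreasing]); and t sinhc_p(c t), whose p-th power A_k is up to
    the factor C at t = t_k, is t if c = 0 and sinh_p(c t) / c otherwise. *)

(** * Monotonicity of sinh_p *)

Section Slope.
Variables (R : realType) (f d : R -> R).
Hypothesis slope_cvg : forall t, 0 <= t ->
  (f u - f t) / (u - t) @[u --> within `[0, +oo[ t^'] --> d t.

Lemma slope_is_derive (t : R) : 0 < t -> is_derive t 1 f (d t).
Proof.
move=> t0.
have dt : (h^-1 *: (f (h *: 1 + t) - f t)) @[h --> 0^'] --> d t.
  have /cvgrPdist_lt slope_t := slope_cvg (ltW t0).
  apply/cvgrPdist_lt => e e0; have := slope_t _ e0.
  rewrite !near_withinE => /nbhs0P near_t.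
  have h_gtNt : \forall h \near (0 : R), - t < h by apply: lt_nbhsr; rewrite oppr_lt0.
  apply: filterS2 near_t h_gtNt => h slope_h th h0; move: slope_h.
  rewrite [t + h]addrC addrK /GRing.scale /= mulr1 [_ * h^-1]mulrC; apply.
    by rewrite -subr_eq0 addrK.
  by rewrite in_itv /= andbT -lerBlDr sub0r ltW.
by apply: DeriveDef; [apply/cvg_ex; exists (d t) | apply/cvg_lim].
Qed.

(** At [t = 0] the one-sided slope gives no two-sided derivative; this is the
    continuity that the mean value theorem needs at the left endpoint. *)
Lemma slope_right_continuous (t : R) : 0 <= t -> f @ t^'+ --> f t.
Proof.
move=> t0.
have slope_right : (f u - f t) / (u - t) @[u --> t^'+] --> d t.
  apply/cvgrPdist_lt => e e0.
  have /cvgrPdist_lt/(_ _ e0) := slope_cvg t0; rewrite !near_withinE.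
  apply: filterS => u slope_u tu; apply: slope_u.
    by rewrite gt_eqF.
  by rewrite /= in_itv /= andbT (le_trans t0 (ltW tu)).
have -> : f t = f t + d t * (t - t) by rewrite subrr mulr0 addr0.
apply: (@cvg_trans _ ((fun u => f t + (f u - f t) / (u - t) * (u - t)) @ t^'+)).
  apply: near_eq_cvg; near=> u.
  have ut : u - t != 0.
    by rewrite subr_eq0 gt_eqF//; near: u; apply: nbhs_right_gt.
  by rewrite divfK// addrC subrK.
apply: cvgD; first exact: cvg_cst.
apply: cvgM => //; apply: cvg_at_right_filter.
by apply: cvgB; [exact: cvg_id | exact: cvg_cst].
Unshelve. all: by end_near. Qed.

Lemma slope_nondecreasing (a b : R) :
  (forall t, 0 <= t -> 0 <= d t) -> 0 <= a -> a <= b -> f a <= f b.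
Proof.
move=> d_ge0 a0; rewrite le_eqVlt => /predU1P[->//|ab].
have f_deriv t : a < t -> is_derive t 1 f (d t).
  by move=> lt_at; apply: slope_is_derive; apply: le_lt_trans lt_at.
have f_cont t : a < t -> {for t, continuous f}.
  move=> /f_deriv ft; apply: differentiable_continuous.
  exact/derivable1_diffP/ex_derive.
have [| |c /itvP cab fab] := @MVT_segment _ f d _ _ (ltW ab).
- by move=> t /itvP tab; apply: f_deriv; rewrite tab.
- apply/(continuous_within_itvP _ ab); split.
  + by move=> t /itvP tab; apply: f_cont; rewrite tab.
  + exact: slope_right_continuous.
  + by apply: cvg_at_left_filter; apply: f_cont.
rewrite -subr_ge0 fab mulr_ge0 ?subr_ge0 ?(ltW ab)// d_ge0//.
by rewrite (le_trans a0) ?cab.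
Qed.
End Slope.

Lemma sinhp_nondecreasing (R : realType) (p : nat) (sinhp : R -> R) (a b : R) :
  is_sinhp p sinhp -> 0 <= a -> a <= b -> sinhp a <= sinhp b.
Proof.
by move=> [_ slope]; apply: (slope_nondecreasing slope) => t _; apply: powR_ge0.
Qed.

Lemma sinhp_ge0 (R : realType) (p : nat) (sinhp : R -> R) (a : R) :
  is_sinhp p sinhp -> 0 <= a -> 0 <= sinhp a.
Proof.
move=> Hs a0; have [<- _] := Hs; exact: (sinhp_nondecreasing Hs).
Qed.

(** The factor [t] cancels the quotient in [sinhc], so the point [t = 0] follows
    the same formula as the others. *)
Lemma mulr_sinhc (R : realType) (p : nat) (sinhp : R -> R) (c t : R) :
  is_sinhp p sinhp ->
  t * sinhc sinhp (c * t) = if c == 0 then t else sinhp (c * t) / c.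
Proof.
move=> [s0 _]; rewrite /sinhc mulf_eq0.
have [_|c0] /= := eqVneq c 0; first by rewrite mulr1.
have [->|t0] := eqVneq t 0; first by rewrite mulr0 s0 !mul0r.
by field; rewrite c0 t0.
Qed.

Lemma mulr_sinhc_ge0 (R : realType) (p : nat) (sinhp : R -> R) (c t : R) :
  is_sinhp p sinhp -> 0 <= c -> 0 <= t -> 0 <= t * sinhc sinhp (c * t).
Proof.
move=> Hs c0 t0; rewrite (mulr_sinhc _ _ Hs); case: eqP => // _.
by rewrite divr_ge0// (sinhp_ge0 Hs)// mulr_ge0.
Qed.

Lemma mulr_sinhc_nondecreasing (R : realType) (p : nat) (sinhp : R -> R)
    (c t u : R) :
  is_sinhp p sinhp -> 0 <= c -> 0 <= t -> t <= u ->
  t * sinhc sinhp (c * t) <= u * sinhc sinhp (c * u).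
Proof.
move=> Hs c0 t0 tu; rewrite !(mulr_sinhc _ _ Hs); case: eqP => // _.
by rewrite ler_wpM2r ?invr_ge0// (sinhp_nondecreasing Hs)// ?mulr_ge0// ler_wpM2l.
Qed.

(** * Euclidean inner product and stationarity *)

Section Dot.
Variables (R : realType) (n : nat).
Implicit Types (u v w : 'rV[R]_n) (a : R).

Lemma dotC u v : dot u v = dot v u.
Proof. by apply: eq_bigr => i _; rewrite mulrC. Qed.

Lemma dotDr u v w : dot u (v + w) = dot u v + dot u w.
Proof. by rewrite -big_split; apply: eq_bigr => i _; rewrite mxE mulrDr. Qed.

Lemma dotZr a u v : dot u (a *: v) = a * dot u v.
Proof. by rewrite mulr_sumr; apply: eq_bigr => i _; rewrite mxE mulrCA. Qed.

Lemma dotNr u v : dot u (- v) = - dot u v.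
Proof. by rewrite -scaleN1r dotZr mulN1r. Qed.

Lemma dotBr u v w : dot u (v - w) = dot u v - dot u w.
Proof. by rewrite dotDr dotNr. Qed.

Lemma dotDl u v w : dot (v + w) u = dot v u + dot w u.
Proof. by rewrite dotC dotDr !(dotC u). Qed.

Lemma dotBl u v w : dot (v - w) u = dot v u - dot w u.
Proof. by rewrite dotC dotBr !(dotC u). Qed.

Lemma dotZl a u v : dot (a *: v) u = a * dot v u.
Proof. by rewrite dotC dotZr (dotC u). Qed.

Lemma dot_ge0 u : 0 <= dot u u.
Proof. by apply: sumr_ge0 => i _; rewrite -expr2 sqr_ge0. Qed.

Lemma dot_eq0 u : dot u u = 0 -> u = 0.
Proof.
move=> /eqP; rewrite psumr_eq0 => [/allP uu0|i _]; last by rewrite -expr2 sqr_ge0.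
apply/rowP => i; rewrite mxE; apply/eqP.
by have := uu0 i (mem_index_enum _); rewrite /= mulf_eq0 orbb.
Qed.

Lemma enorm_ge0 u : 0 <= enorm u.
Proof. exact: sqrtr_ge0. Qed.

Lemma enorm_sqr u : enorm u ^+ 2 = dot u u.
Proof. by rewrite sqr_sqrtr ?dot_ge0. Qed.

(** For nonzero vectors, expand the square of [enorm v *: u - enorm u *: v]. *)
Lemma cauchy_schwarz u v : dot u v <= enorm u * enorm v.
Proof.
have [u0|u0] := eqVneq (enorm u) 0.
  have /dot_eq0 -> : dot u u = 0 by rewrite -enorm_sqr u0 expr0n.
  rewrite -(scale0r (0 : 'rV[R]_n)) dotZl mul0r mulr_ge0 ?enorm_ge0//.
have [v0|v0] := eqVneq (enorm v) 0.
  have /dot_eq0 -> : dot v v = 0 by rewrite -enorm_sqr v0 expr0n.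
  rewrite -(scale0r (0 : 'rV[R]_n)) dotZr mul0r mulr_ge0 ?enorm_ge0//.
have nu : 0 < enorm u by rewrite lt_def u0 enorm_ge0.
have nv : 0 < enorm v by rewrite lt_def v0 enorm_ge0.
have := dot_ge0 (enorm v *: u - enorm u *: v).
rewrite dotBr !dotZr !dotBl !dotZl (dotC v u) -!enorm_sqr => ineq.
rewrite -(ler_pM2l (mulr_gt0 nu nv)); lra.
Qed.

Lemma diff_dot_grad (g : 'rV[R]_n -> R) x v : 'd g x v = dot (grad g x) v :> R.
Proof.
rewrite [in LHS](row_sum_delta v) linear_sum; apply: eq_bigr => i _.
by rewrite linearZ mxE mulrC.
Qed.

Lemma is_derive_line (g : 'rV[R]_n -> R) (w u : 'rV[R]_n) (t : R) :
  differentiable g (t *: u + w) ->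
  is_derive t 1 (fun e => g (e *: u + w)) (dot (grad g (t *: u + w)) u).
Proof.
move=> g_diff.
have slopeE : (fun h : R => h^-1 *: (g ((h *: 1 + t) *: u + w) - g (t *: u + w)))
    = (fun h => h^-1 *: (g (h *: u + (t *: u + w)) - g (t *: u + w))).
  by apply/funext => h; rewrite [h *: 1]mulr1 scalerDl addrA.
have g_der : derivable g (t *: u + w) u by exact: diff_derivable.
apply: DeriveDef; first by rewrite /derivable /= slopeE.
by rewrite /derive /= slopeE -/(derive g (t *: u + w) u) deriveE// diff_dot_grad.
Qed.

(** Fermat's rule on the line through [w] whose direction is the putative
    gradient itself: the derivative along it is the square of that gradient. *)
Lemma argmin_grad (h : 'rV[R]_n -> R) (b : R) (c w : 'rV[R]_n) :
  (forall v, differentiable h v) ->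
  is_argmin (fun v => dot c v + b * h v) w ->
  c + b *: grad h w = 0.
Proof.
move=> h_diff w_min; apply: dot_eq0.
set u := c + _.
pose psi (e : R) := e * dot c u + b * h (e *: u + w).
have psi_der (t : R) :
    is_derive t 1 psi (dot c u + b * dot (grad h (t *: u + w)) u).
  have := is_derive_line (h_diff (t *: u + w)) => line_der.
  apply: (@is_derive_eq _ _ _ _ _ _ _ _ (is_deriveD (is_deriveM (is_derive_id t 1)
    (is_derive_cst (dot c u) t 1)) (is_deriveZ b line_der))).
  by rewrite scaler0 add0r /GRing.scale /= mulr1.
have [] := @derive1_at_min _ psi (-1) 1 0 _ _ _ _.
- by lra.
- by move=> t _; have [] := psi_der t.
- by rewrite in_itv /= oppr_lt0 ltr01.
- move=> t _; have := w_min (t *: u + w); rewrite /psi.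
  rewrite scale0r add0r mul0r dotDr dotZr; lra.
move=> _; have [_ ->] := psi_der 0.
by rewrite scale0r add0r -dotZl -dotDl.
Qed.
End Dot.

(** * Young's inequality in powers *)

(** Passing from [m] to [m.+1], the defect of the inequality is multiplied by
    [y] and grows by [m.+1 * x ^+ m * (x - y) ^+ 2]. *)
Lemma weighted_agm (R : realDomainType) (m : nat) (x y : R) : 0 <= x -> 0 <= y ->
  m.+1%:R * (x ^+ m * y) <= m%:R * x ^+ m.+1 + y ^+ m.+1.
Proof.
move=> x0 y0; elim: m => [|m IH]; first by rewrite expr0 !mul1r mul0r add0r.
rewrite -subr_ge0.
have -> : m.+1%:R * x ^+ m.+2 + y ^+ m.+2 - m.+2%:R * (x ^+ m.+1 * y)
    = y * (m%:R * x ^+ m.+1 + y ^+ m.+1 - m.+1%:R * (x ^+ m * y))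
      + m.+1%:R * (x ^+ m * (x - y) ^+ 2).
  by rewrite -!natr1 !exprS; ring.
apply: addr_ge0; first by rewrite mulr_ge0// subr_ge0.
by rewrite mulr_ge0// mulr_ge0 ?sqr_ge0 ?exprn_ge0.
Qed.

Lemma powR_root (R : realType) (m : nat) (a : R) : 0 <= a ->
  (a `^ (m.+1%:R^-1)) ^+ m.+1 = a.
Proof.
by move=> a0; rewrite -powR_mulrn ?powR_ge0// -powRrM mulVf ?pnatr_eq0// powRr1.
Qed.

(** Writing [K] and [B] as [m.+1]-st powers of [k] and [b], the hypothesis says
    [a <= k ^+ m * b], and the conclusion is the weighted arithmetic-geometric
    mean inequality for [k * g] and [b * r]. *)
Lemma young_step (R : realType) (m : nat) (a B K g r : R) :
  0 <= B -> 0 <= K -> 0 <= g -> 0 <= r ->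
  a ^+ m.+1 <= K ^+ m * B ->
  m.+1%:R * (a * (g ^+ m * r)) <= m%:R * (K * g ^+ m.+1) + B * r ^+ m.+1.
Proof.
move=> B0 K0 g0 r0 aKB.
pose b := B `^ (m.+1%:R^-1); pose k := K `^ (m.+1%:R^-1).
have b0 : 0 <= b by exact: powR_ge0.
have k0 : 0 <= k by exact: powR_ge0.
have bE : B = b ^+ m.+1 by rewrite powR_root.
have kE : K = k ^+ m.+1 by rewrite powR_root.
have a_le : a <= k ^+ m * b.
  have kb0 : 0 <= k ^+ m * b by rewrite mulr_ge0 ?exprn_ge0.
  have [a0|/ltW a0] := lerP 0 a; last exact: le_trans kb0.
  rewrite -(@ler_pXn2r _ m.+1)// exprMn -exprM mulnC exprM.
  by rewrite -kE -bE.
have /= := @weighted_agm R m _ _ (mulr_ge0 k0 g0) (mulr_ge0 b0 r0).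
rewrite !exprMn -bE -kE; apply: le_trans.
rewrite ler_wpM2l//.
have -> : k ^+ m * g ^+ m * (b * r) = k ^+ m * b * (g ^+ m * r) by ring.
by rewrite ler_wpM2r// mulr_ge0// exprn_ge0.
Qed.

(** The powers of [s] and [g] have denominator [p.-1]; in terms of the
    [p.-1]-st roots [sig] and [gam] every exponent is a natural number and
    [young_step] applies to [gam] and [r]. *)
Lemma tensor_step_young (R : realType) (p : nat) (a A' B M s C g r : R) :
  (2 <= p)%N -> 0 <= A' -> 0 <= B -> 0 <= M -> 0 <= s -> 0 <= g -> 0 <= r ->
  C = p%:R^-1 * (M / p.-1%:R) ^+ p.-1 ->
  a ^+ p - C * p%:R ^+ p * s * A' ^+ p.-1 * B <= 0 ->
  a * (g * r) <= A' * (M * s `^ (p.-1%:R^-1) * g `^ (p%:R / p.-1%:R))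
                 + B * (p%:R^-1 * r ^+ p).
Proof.
case: p => [//|[//|m]] _ A'0 B0 M0 s0 g0 r0 -> /=.
rewrite subr_le0 => a_le.
pose sig := s `^ (m.+1%:R^-1); pose gam := g `^ (m.+1%:R^-1).
have sigE : sig ^+ m.+1 = s by exact: powR_root.
have gamE : gam ^+ m.+1 = g by exact: powR_root.
have gampE : g `^ (m.+2%:R / m.+1%:R) = gam ^+ m.+2.
  by rewrite -powR_mulrn ?powR_ge0// -powRrM mulrC.
have sig0 : 0 <= sig by exact: powR_ge0.
have gam0 : 0 <= gam by exact: powR_ge0.
have p0 : (m.+2%:R : R) != 0 by rewrite pnatr_eq0.
have m0 : (m.+1%:R : R) != 0 by rewrite pnatr_eq0.
(* The growth condition is [a ^+ p <= K ^+ p.-1 * B] for this [K]. *)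
pose K := A' * M * sig * (m.+2%:R / m.+1%:R).
have K0 : 0 <= K by rewrite !mulr_ge0 ?divr_ge0.
have aKB : a ^+ m.+2 <= K ^+ m.+1 * B.
  apply: le_trans a_le _; rewrite /K -sigE [m.+2%:R ^+ m.+2]exprS !exprMn.
  by rewrite le_eqVlt; apply/predU1P; left; field; rewrite ?p0 ?m0 ?expf_neq0.
have := young_step B0 K0 gam0 r0 aKB.
rewrite gamE gampE -/sig => young.
have p_gt0 : 0 < (m.+2%:R : R) by rewrite ltr0n.
rewrite -(ler_pM2l p_gt0); apply: le_trans young _.
rewrite /K le_eqVlt; apply/predU1P; left.
move: (m.+2%:R : R) (m.+1%:R : R) p0 m0 => P Q p0 m0.
by field; rewrite p0 m0.
Qed.

(** * One step of the energy estimate *)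

(* Turns inner products and Bregman divergences into scalar variables, so that
   [ring] and [lra] do not compare them by unfolding sums and differentials. *)
Ltac dots_to_scalars :=
  repeat match goal with
  | |- context [dot ?u ?v] => generalize (dot u v); intro
  | |- context [bregman ?g ?u ?v] => generalize (bregman g u v); intro
  end.

Lemma bregmanE (R : realType) (n : nat) (h : 'rV[R]_n -> R) (v x : 'rV[R]_n) :
  bregman h v x = h v - h x - (dot (grad h x) v - dot (grad h x) x).
Proof. by rewrite /bregman dotBr. Qed.

Section Energy.
Variables (R : realType) (n : nat).
Local Notation V := 'rV[R]_n.
Variable h : V -> R.
Hypothesis h_diff : forall v, differentiable h v.

(** Up to an affine function, [phi] is [(1 + al * mu) * h], so its Bregman
    divergence is [1 + al * mu] times that of [h]; at the minimizer [z'] the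
    first-order term vanishes. *)
Lemma bregman_argmin (al mu : R) (g x z z' : V) :
  let phi w := al * (dot g w + mu * bregman h w x) + bregman h w z in
  is_argmin phi z' ->
  forall w, phi w = phi z' + (1 + al * mu) * bregman h w z'.
Proof.
move=> phi z'_min w.
pose c := al *: g - (al * mu) *: grad h x - grad h z.
have phiE v : phi v = dot c v + (1 + al * mu) * h v + (al * mu *
    (dot (grad h x) x - h x) + dot (grad h z) z - h z).
  rewrite /phi !bregmanE /c !dotBl !dotZl.
  by dots_to_scalars; ring.
have : c + (1 + al * mu) *: grad h z' = 0.
  apply: argmin_grad => // v.
  by have := z'_min v; rewrite !phiE lerD2r.
move=> /(congr1 (fun u => dot u (w - z'))) /=.
rewrite dotDl dotZl -[in X in _ = X](scale0r (0 : V)) dotZl mul0r.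
rewrite dotBr dotBr => stat.
by rewrite !phiE !bregmanE; move: stat; dots_to_scalars; lra.
Qed.

Variables (mu : R) (f : V -> R) (xs : V).
Hypothesis mu_ge0 : 0 <= mu.
Hypothesis h_ge0 : forall u v, 0 <= bregman h u v.
Hypothesis f_unif : forall u v, mu * bregman h u v <= bregman f u v.

Definition energy (A : R) (x z : V) : R :=
  (1 + mu * A) * bregman h xs z + A * (f x - f xs).

(** Here [x'] is an arbitrary point at which the gradient is taken; it is the
    choice of [x'] from [y] that must make the sum of the three error terms
    nonpositive. *)
Lemma energy_step (A A' : R) (x y z x' z' : V) :
  0 <= A -> A <= A' -> A' *: y = A *: x + (A' - A) *: z ->
  is_argmin (fun w => (A' - A) / (1 + mu * A) *
      (dot (grad f x') w + mu * bregman h w x') + bregman h w z) z' ->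
  energy A' x' z' <= energy A x z
    - A' * dot (grad f x') (y - x') + (A' - A) * dot (grad f x') (z - z')
    - (1 + mu * A) * bregman h z' z.
Proof.
move=> A0 AA' yE z'_min; set B := 1 + mu * A.
have B0 : 0 < B by rewrite ltr_pwDl// mulr_ge0.
have := bregman_argmin z'_min xs; rewrite /= -/B.
set g := grad f x' in yE *; move=> /(congr1 ( *%R B)).
set al := _ / B; have BalE : B * al = A' - A by rewrite mulrC divfK ?gt_eqF.
have al_exp t u : B * (al * t + u) = (A' - A) * t + B * u.
  by rewrite mulrDr mulrA BalE.
rewrite al_exp [in X in _ = X]mulrDr al_exp mulrA.
have -> : B * (1 + al * mu) = 1 + mu * A'.
  by rewrite mulrDr mulr1 mulrA BalE /B; ring.
move=> step.
have f_xs : (A' - A) * (dot g xs + mu * bregman h xs x')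
    <= (A' - A) * (f xs - f x' + dot g x').
  rewrite ler_wpM2l ?subr_ge0//.
  have := f_unif xs x'; rewrite [bregman f _ _]bregmanE -/g.
  by dots_to_scalars; lra.
have f_x : A * dot g (x - x') <= A * (f x - f x').
  rewrite ler_wpM2l//.
  have := f_unif x x'; have := mulr_ge0 mu_ge0 (h_ge0 x x').
  rewrite [bregman f _ _]bregmanE -/g dotBr.
  by dots_to_scalars; lra.
have D0 : 0 <= (A' - A) * (mu * bregman h z' x').
  by rewrite mulr_ge0 ?subr_ge0// mulr_ge0.
have yg : A' * dot g y = A * dot g x + (A' - A) * dot g z.
  by have := congr1 (dot g) yE; rewrite dotDr !dotZr.
rewrite /energy -/B; move: f_x; rewrite !dotBr => f_x.
by move: D0 f_xs step f_x yg; dots_to_scalars; lra.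
Qed.
End Energy.

(** * The convergence rate *)

Theorem corollary18 (R : realType) (n p : nat) (mu s M C : R)
    (h f : 'rV[R]_n -> R) (xstar : 'rV[R]_n) (G : 'rV[R]_n -> 'rV[R]_n)
    (sinhp : R -> R) (t A : nat -> R) (x y z : nat -> 'rV[R]_n)
    (hp : (2 <= p)%N) (hmu : 0 <= mu) (hs : 0 < s)
    (h_C1 : continuously_differentiable h)
    (h_unif : uniformly_convex_of_order 1 p h)
    (f_C1 : continuously_differentiable f)
    (f_diff : times_differentiable p.-1 f)
    (f_unif : uniformly_convex_wrt mu h f)
    (f_smooth : smooth_of_order p.-1 ((p.-1)`!%:R / s) f)
    (f_min : is_argmin f xstar)
    (hM : 0 < M) (hG : tensor_update_operator p s M f G)
    (hC : C = p%:R^-1 * (M / p.-1%:R) ^+ p.-1)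
    (hsinhp : is_sinhp p sinhp)
    (t_ge0 : forall k, 0 <= t k) (t_incr : increasing_seq t)
    (hA : forall k, A k = C * t k ^+ p *
       sinhc sinhp (C `^ (p%:R^-1) * mu `^ (p%:R^-1) * t k) ^+ p)
    (A_cond : forall k,
       (A k.+1 - A k) ^+ p
         - C * p%:R ^+ p * s * A k.+1 ^+ p.-1 * (1 + mu * A k) <= 0)
    (xz0 : x 0%N = z 0%N)
    (hy : forall k, y k = x k + ((A k.+1 - A k) / A k.+1) *: (z k - x k))
    (hx : forall k, x k.+1 = G (y k))
    (hz : forall k, is_argmin (fun w : 'rV[R]_n =>
       (A k.+1 - A k) / (1 + mu * A k) *
         (dot (grad f (x k.+1)) w + mu * bregman h w (x k.+1))
       + bregman h w (z k)) (z k.+1)) :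
  forall k, 0 < A k ->
    f (x k) - f xstar <=
      (A k)^-1 * ((1 + mu * A 0%N) * bregman h xstar (x 0%N)
                  + A 0%N * (f (x 0%N) - f xstar)).
Proof.
have [c c_ge0 {}hA] : exists2 c, 0 <= c &
    forall k, A k = C * (t k * sinhc sinhp (c * t k)) ^+ p.
  exists (C `^ (p%:R^-1) * mu `^ (p%:R^-1)); first by rewrite mulr_ge0 ?powR_ge0.
  by move=> k; rewrite hA exprMn mulrA.
have C_ge0 : 0 <= C.
  by rewrite hC mulr_ge0 ?invr_ge0// exprn_ge0// divr_ge0// ltW.
have h_ge0 u v : 0 <= bregman h u v.
  apply: le_trans (h_unif v u).
  by rewrite mulr_ge0 ?divr_ge0// exprn_ge0// enorm_ge0.
have sinhc_t_ge0 k : 0 <= t k * sinhc sinhp (c * t k).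
  exact: (mulr_sinhc_ge0 hsinhp).
have A_ge0 k : 0 <= A k by rewrite hA mulr_ge0// exprn_ge0.
have A_nondecr k : A k <= A k.+1.
  rewrite !hA ler_wpM2l// lerXn2r ?nnegrE//.
  by apply: (mulr_sinhc_nondecreasing hsinhp) => //; rewrite t_incr.
have y_comb k : A k.+1 *: y k = A k *: x k + (A k.+1 - A k) *: z k.
  (* If [A k.+1 = 0] the quotient in [hy] is meaningless, but then [A k = 0]. *)
  have [A'0|A'0] := eqVneq (A k.+1) 0.
    have A0 : A k = 0 by apply/le_anti; rewrite A_ge0 -A'0 A_nondecr.
    by rewrite A'0 A0 subrr !scale0r addr0.
  rewrite hy scalerDr scalerA mulrCA divff// mulr1 scalerBr.
  by rewrite addrCA -scalerBl opprB addrCA subrr addr0 addrC.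
have decr k : energy h mu f xstar (A k.+1) (x k.+1) (z k.+1)
    <= energy h mu f xstar (A k) (x k) (z k).
  apply: le_trans (energy_step h_C1.1 xstar hmu h_ge0 f_unif.2 (A_ge0 k) (A_nondecr k)
    (y_comb k) (hz k)) _.
  have [N [_ _ G_descent]] := hG.
  have descent := ler_wpM2l (A_ge0 k.+1) (G_descent (y k)).
  have B_ge0 : 0 <= 1 + mu * A k by rewrite addr_ge0// mulr_ge0.
  have h_pow := ler_wpM2l B_ge0 (h_unif (z k) (z k.+1)).
  have a_ge0 : 0 <= A k.+1 - A k by rewrite subr_ge0.
  have cs := ler_wpM2l a_ge0 (cauchy_schwarz (grad f (x k.+1)) (z k - z k.+1)).
  have young := tensor_step_young hp (A_ge0 k.+1) B_ge0 (ltW hM) (ltW hs)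
    (enorm_ge0 (grad f (x k.+1))) (enorm_ge0 (z k - z k.+1)) hC (A_cond k).
  rewrite -hx in descent.
  have enormC : enorm (z k.+1 - z k) = enorm (z k - z k.+1).
    by rewrite /enorm -opprB !dotNr dotC dotNr opprK.
  rewrite enormC mul1r in h_pow.
  have : - (A k.+1 * dot (grad f (x k.+1)) (y k - x k.+1))
      + (A k.+1 - A k) * dot (grad f (x k.+1)) (z k - z k.+1)
      - (1 + mu * A k) * bregman h (z k.+1) (z k) <= 0.
    rewrite -subr_ge0 sub0r.
    have := le_trans cs (le_trans young (lerD descent h_pow)).
    by dots_to_scalars; lra.
  by dots_to_scalars; move: (energy _ _ _ _ _ _ _) => ? ?; lra.
move=> k Ak; rewrite mulrC ler_pdivlMr// mulrC.
have : energy h mu f xstar (A k) (x k) (z k)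
    <= energy h mu f xstar (A 0%N) (x 0%N) (z 0%N).
  by elim: k {Ak} => // k; apply: le_trans.
rewrite /energy -xz0; apply: le_trans.
by rewrite lerDr mulr_ge0// addr_ge0// mulr_ge0.
Qed.
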